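(* There exists $k_0$ such that for every integer $k\ge k_0$, every positive integer $n$, and every $k$-AP-intersecting family $\mathcal{A}$ of subsets of $[n]$, we have $\mu(\mathcal{A})\le k^{-1/3}$.
   Context: $[n]=\{1,\dots,n\}$. For a family $\mathcal{A}$ of subsets of $[n]$, $\mu(\mathcal{A})=|\mathcal{A}|/2^n$. A $k$-AP is an arithmetic progression $\{a,a+d,\dots,a+(k-1)d\}$ of $k$ distinct integers ($d\neq 0$). A family $\mathcal{A}$ is $k$-AP-intersecting if for all $A,B\in\mathcal{A}$ (including the case $A=B$) the set $A\cap B$ contains a $k$-AP. *)

(* Defs.v *)
From HB Require Import structures.
From mathcomp Require Import all_boot all_order all_algebra.
From mathcomp Require Import reals.

Set Implicit Arguments.
Unset Strict Implicit.
Unset Printing Implicit Defensive.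

Import Order.TTheory GRing.Theory Num.Theory.

Local Open Scope ring_scope.

(* The ground set [n] = {1, ..., n} is encoded by 'I_n, the ordinal i standing
   for the integer i + 1. *)
Definition elt (n : nat) (i : 'I_n) : int := i.+1%:Z.

(* Since d != 0, the k terms a, a + d, ..., a + (k - 1) d are distinct. *)
Definition contains_AP (k n : nat) (S : {set 'I_n}) : Prop :=
  exists a d : int, d != 0 /\
    forall j : nat, (j < k)%N -> exists2 i : 'I_n, i \in S & elt i = a + j%:Z * d.

Definition AP_intersecting (k n : nat) (F : {set {set 'I_n}}) : Prop :=
  forall A B : {set 'I_n}, A \in F -> B \in F -> contains_AP k (A :&: B).

Definition mu (R : realType) (n : nat) (F : {set {set 'I_n}}) : R :=
  #|F|%:R / 2%:R ^+ n.

(* Main.v *)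
(* Let [B] be uniform in the family [F], of density [mu]. Revealing [B] one
   coordinate at a time and flipping each coordinate with a probability
   [r_i(B) <= 1/2] correcting its conditional bias produces a uniform set [U];
   given [B] the flips are independent, and the total quadratic cost
   [L(B) = sum_i r_i(B)^2] has mean at most [4 / sqrt mu] (Marton's transport
   argument). The set [A = ~: U] lies in [F] with probability [mu], and then
   [A :&: B], which consists of flipped coordinates only, contains a k-AP.
   A k-AP is determined by its terms 0, 1 and also by its terms 2, 3, so by
   AM-GM the expected number of fully flipped k-APs is at most
   [2^(4-k) L(B)^2], whatever [n] is. As [min(1, x^2) <= x], averaging over [B]
   gives [mu^3 <= 256 / 2^k]. *)
Require Import Defs.
From mathcomp Require Import all_boot all_order all_algebra.
From mathcomp Require Import reals exp.
From mathcomp Require Import zify ring lra.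

Set Implicit Arguments.
Unset Strict Implicit.
Unset Printing Implicit Defensive.

Import Order.TTheory GRing.Theory Num.Theory.

Local Open Scope ring_scope.

(** * Flip rates that make a member of the family uniform *)

(** With [x], [y], [z], [c] the roots of [a], [b], [N], [2 (a + b)], one has
    [c^2 - (x + y)^2 = (x - y)^2]. Since [c + x + y <= 4 x <= 4 z], the concavity gap
    [4 z (c - x - y)] is at least [(x - y)^2], which dominates the cost term. *)
Lemma sqrt_split_gap (R : rcfType) (a b N : R) :
  0 <= b -> b <= a -> a <= N ->
  a * ((a - b) / (2 * a)) ^+ 2 + 4 * Num.sqrt (a * N) + 4 * Num.sqrt (b * N)
    <= 4 * Num.sqrt ((a + b) * (2 * N)).
Proof.
move=> b0 ba aN.
have a0 : 0 <= a := le_trans b0 ba.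
have N0 : 0 <= N := le_trans a0 aN.
have [az|an0] := eqVneq a 0.
  have bz : b = 0 by apply/eqP; rewrite eq_le b0 -az ba.
  by rewrite az bz !(mul0r, addr0, sqrtr0, mulr0).
have ap : 0 < a by rewrite lt_neqAle eq_sym an0.
have abN : 0 <= (a + b) * 2 by rewrite mulr_ge0 ?addr_ge0.
rewrite (mulrA _ 2) (sqrtrM _ a0) (sqrtrM _ b0) (sqrtrM _ abN).
have sa := sqr_sqrtr a0; have sb := sqr_sqrtr b0.
have sc := sqr_sqrtr abN.
have saN : Num.sqrt a <= Num.sqrt N by rewrite ler_sqrt.
have sba : Num.sqrt b <= Num.sqrt a by rewrite ler_sqrt.
have sap : 0 < Num.sqrt a by rewrite sqrtr_gt0.
have := sqrtr_ge0 b; have := sqrtr_ge0 ((a + b) * 2).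
move: (Num.sqrt a) (Num.sqrt b) (Num.sqrt N) (Num.sqrt ((a + b) * 2)) sa sb sc saN sba sap.
move=> x y z c sa sb + xz yx x0 c0 y0; rewrite -sa -sb => xyc.
have sq_le u v : 0 <= u -> 0 <= v -> u ^+ 2 <= v ^+ 2 -> u <= v :> R.
  by move=> u0 v0; rewrite ler_sqr.
have cxy : x + y <= c.
  have := sqr_ge0 (x - y).
  by move=> ?; apply: sq_le => //; [lra | rewrite xyc; lra].
have cx : c + x + y <= 4 * x.
  suff : c <= 2 * x by lra.
  have : y ^+ 2 <= x ^+ 2 by rewrite ler_sqr // nnegrE ltW.
  by move=> ?; apply: sq_le => //; [lra | rewrite xyc; lra].
have gap : (x - y) ^+ 2 <= 4 * z * (c - x - y).
  have -> : (x - y) ^+ 2 = (c + x + y) * (c - x - y).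
    have -> : (c + x + y) * (c - x - y) = c ^+ 2 - (x + y) ^+ 2 by ring.
    by rewrite xyc; ring.
  by apply: ler_wpM2r; lra.
have step : x ^+ 2 * ((x ^+ 2 - y ^+ 2) / (2 * x ^+ 2)) ^+ 2 <= (x - y) ^+ 2.
  have -> : x ^+ 2 * ((x ^+ 2 - y ^+ 2) / (2 * x ^+ 2)) ^+ 2
          = (x - y) ^+ 2 * ((x + y) / (2 * x)) ^+ 2 by field; rewrite gt_eqF.
  rewrite ler_piMr ?sqr_ge0 // expr_le1 //; last by rewrite divr_ge0; lra.
  by rewrite ler_pdivrMr ?mulr_gt0 //; lra.
apply: le_trans (lerD (lerD step (lexx _)) (lexx _)) _.
lra.
Qed.

(** The probability that [B], once each coordinate [i] of [s] is flipped independently with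
    probability [r i], agrees with [U] on [s]. *)
Definition flip_weight (R : nzRingType) (T : finType) (r : T -> R)
    (s : seq T) (B U : {set T}) : R :=
  \prod_(i <- s) if (i \in U) == (i \in B) then 1 - r i else r i.

(* With [a >= b] members of [F] that do and do not contain the coordinate being
   revealed, the former are flipped with probability [(a - b) / (2 a)]; the
   potential [4 sqrt (|F| 2^|s|)] is concave enough in [|F|] to pay for it. *)
Lemma flip_rates (R : rcfType) (T : finType) (s : seq T)
    (F : {set {set T}}) :
  uniq s ->
  {in F &, forall B C : {set T}, {in s, forall i, (i \in B) = (i \in C)} -> B = C} ->
  (#|F| <= 2 ^ size s)%N /\
  exists r : {set T} -> T -> R,
  [/\ forall B i, 0 <= r B i <= 2^-1,
      forall U, \sum_(B in F) flip_weight (r B) s B U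
                = #|F|%:R / 2%:R ^+ size s
    & \sum_(B in F) \sum_(i <- s) r B i ^+ 2
        <= 4 * Num.sqrt (#|F|%:R * 2%:R ^+ size s)].
Proof.
elim: s F => [|x s IH] F /=.
  move=> _ Finj; split.
    by apply/card_le1_eqP => B C BF CF; apply: Finj.
  exists (fun _ _ => 0); split=> [B i|U|].
  - by rewrite lexx invr_ge0 ler0n.
  - under eq_bigr => B _ do rewrite /flip_weight big_nil.
    by rewrite sumr_const divr1.
  - under eq_bigr => B _ do rewrite big_nil.
    by rewrite big1 // mulr_ge0 ?sqrtr_ge0.
case/andP=> xs us Finj.
pose F1 := [set B in F | x \in B]; pose F0 := [set B in F | x \notin B].
(* All members of [F1] contain [x] and all those of [F0] omit it, so [s] alone still separates the
   members of each half. *)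
have F1inj : {in F1 &, forall B C : {set T}, {in s, forall i, (i \in B) = (i \in C)} -> B = C}.
  move=> B C; rewrite !inE => /andP[BF xB] /andP[CF xC] eqs.
  by apply: Finj => // i; rewrite inE => /predU1P[->|/eqs//]; rewrite xB xC.
have F0inj : {in F0 &, forall B C : {set T}, {in s, forall i, (i \in B) = (i \in C)} -> B = C}.
  move=> B C; rewrite !inE => /andP[BF xB] /andP[CF xC] eqs.
  apply: Finj => // i; rewrite inE => /predU1P[->|/eqs//].
  by rewrite (negbTE xB) (negbTE xC).
have [le1 [r1 [r1b r1U r1s]]] := IH _ us F1inj.
have [le0 [r0 [r0b r0U r0s]]] := IH _ us F0inj.
have sumF (f : {set T} -> R) :
    \sum_(B in F) f B = \sum_(B in F1) f B + \sum_(B in F0) f B.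
  rewrite (bigID (fun B : {set T} => x \in B)) /=.
  by congr (_ + _); apply: eq_bigl => B; rewrite !inE.
have cF : (#|F| = #|F1| + #|F0|)%N.
  rewrite -!sum1_card (bigID (fun B : {set T} => x \in B)) /=.
  by congr (_ + _)%N; apply: eq_bigl => B; rewrite !inE.
split; first by rewrite expnS mul2n -addnn cF leq_add.
have le1R : #|F1|%:R <= 2%:R ^+ size s :> R by rewrite -natrX ler_nat.
have le0R : #|F0|%:R <= 2%:R ^+ size s :> R by rewrite -natrX ler_nat.
set N := 2%:R ^+ size s in r1U r0U r1s r0s le1R le0R.
have N0 : N != 0 :> R by rewrite expf_neq0 // pnatr_eq0.
have a0 : 0 <= #|F1|%:R :> R by [].
have b0 : 0 <= #|F0|%:R :> R by [].
have sum1 (c : R) : \sum_(B in F1) c = #|F1|%:R * c by rewrite sumr_const mulr_natl.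
have sum0 (c : R) : \sum_(B in F0) c = #|F0|%:R * c by rewrite sumr_const mulr_natl.
rewrite exprS -/N cF natrD.
move: #|F1|%:R #|F0|%:R a0 b0 le1R le0R r1U r0U r1s r0s sum1 sum0.
move=> a b a0 b0 aN bN r1U r0U r1s r0s sum1 sum0.
(* The flip rate for a side of size [u] against one of size [v]: the larger side keeps [(u + v) / 2]
   of its mass, the smaller is never flipped. At [u = v = 0] the quotient is 0 by convention. *)
pose rho (u v : R) := if v <= u then (u - v) / (2 * u) else 0.
have rho_b u v : 0 <= u -> 0 <= v -> 0 <= rho u v <= 2^-1.
  move=> u0 v0; rewrite /rho; case: ifP => [vu|_]; last first.
    by rewrite lexx invr_ge0 ler0n.
  have [->|un0] := eqVneq u 0; first by rewrite mulr0 invr0 mulr0 lexx invr_ge0 ler0n.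
  have up : 0 < 2 * u by rewrite mulr_gt0 // lt_neqAle eq_sym un0.
  rewrite ler_pdivlMr // ler_pdivrMr // mul0r subr_ge0 vu /=; lra.
pose r (B : {set T}) (i : T) := if i == x then (if x \in B then rho a b else rho b a)
              else (if x \in B then r1 B i else r0 B i).
have rx (B : {set T}) : r B x = if x \in B then rho a b else rho b a by rewrite /r eqxx.
have rs (B : {set T}) i : i \in s -> r B i = if x \in B then r1 B i else r0 B i.
  by move=> si; rewrite /r ifN //; apply: contraNneq xs => <-.
exists r; split=> [B i|U|].
- by rewrite /r; do 2 case: ifP => _ //; exact: rho_b.
- have wE (B : {set T}) : flip_weight (r B) (x :: s) B U =
      (if (x \in U) == (x \in B) then 1 - r B x else r B x) *
      flip_weight (if x \in B then r1 B else r0 B) s B U.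
    rewrite /flip_weight big_cons; congr (_ * _).
    by apply: eq_big_seq => i si; rewrite rs //; case: (x \in B).
  rewrite sumF.
  have -> : \sum_(B in F1) flip_weight (r B) (x :: s) B U =
     (if x \in U then 1 - rho a b else rho a b) * (a / N).
    rewrite -(r1U U) mulr_sumr; apply: eq_bigr => B; rewrite inE => /andP[_ xB].
    by rewrite wE rx xB eqb_id.
  have -> : \sum_(B in F0) flip_weight (r B) (x :: s) B U =
     (if x \in U then rho b a else 1 - rho b a) * (b / N).
    rewrite -(r0U U) mulr_sumr; apply: eq_bigr => B; rewrite inE => /andP[_ /negbTE xB].
    by rewrite wE rx xB eqbF_neg if_neg.
  rewrite /rho.
  have [->|an0] := eqVneq a 0; have [->|bn0] := eqVneq b 0.
  + by rewrite !(mul0r, mulr0, addr0).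
  + rewrite b0 leNgt lt_neqAle eq_sym bn0 b0 /=.
    by case: ifP => _; field; rewrite bn0 N0.
  + rewrite a0 [a <= 0]leNgt lt_neqAle eq_sym an0 a0 /=.
    by case: ifP => _; field; rewrite an0 N0.
  + case: (ltgtP a b) => [ab|ab|->]; case: ifP => _; field;
      by rewrite ?an0 ?bn0 ?N0.
- have sE (B : {set T}) : \sum_(i <- x :: s) r B i ^+ 2 =
      r B x ^+ 2 + \sum_(i <- s) (if x \in B then r1 B i else r0 B i) ^+ 2.
    by rewrite big_cons; congr (_ + _); apply: eq_big_seq => i si; rewrite rs.
  have s1 : \sum_(B in F1) \sum_(i <- x :: s) r B i ^+ 2
      <= a * rho a b ^+ 2 + 4 * Num.sqrt (a * N).
    rewrite -sum1; apply: le_trans (lerD (lexx _) r1s).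
    rewrite -big_split /= ler_sum // => B; rewrite inE => /andP[_ xB].
    by rewrite sE rx xB.
  have s0 : \sum_(B in F0) \sum_(i <- x :: s) r B i ^+ 2
      <= b * rho b a ^+ 2 + 4 * Num.sqrt (b * N).
    rewrite -sum0; apply: le_trans (lerD (lexx _) r0s).
    rewrite -big_split /= ler_sum // => B; rewrite inE => /andP[_ /negbTE xB].
    by rewrite sE rx xB.
  rewrite sumF; apply: le_trans (lerD s1 s0) _; rewrite /rho.
  (* Only the larger half pays at [x]; at a tie neither does. *)
  case: (ltgtP a b) => [ab|ab|ab].
  + by have := sqrt_split_gap a0 (ltW ab) bN; rewrite [b + a]addrC; lra.
  + by have := sqrt_split_gap b0 (ltW ab) aN; lra.
  + have ba : b <= a by rewrite ab.
    by have := sqrt_split_gap b0 ba aN; rewrite ab subrr mul0r; lra.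
Qed.

(** * Probability that all of a given set is flipped *)

(** As [A] is the complement of the outcome, each element of [A :&: B] has been flipped, and flips
    are independent. *)
Lemma sum_flip_weight_supset (R : numDomainType) (T : finType) (r : T -> R)
    (B P : {set T}) :
  (forall i, 0 <= r i) ->
  \sum_(A : {set T} | P \subset A :&: B) flip_weight r (enum T) B (~: A)
    <= \prod_(i in P) r i.
Proof.
move=> r0; have [PB|/negbTE PB] := boolP (P \subset B); last first.
  by rewrite [leLHS]big_pred0 ?prodr_ge0 // => A; rewrite subsetI PB andbF.
(* [E i] is the weight of [i \in A] and [G i] that of [i \notin A], set to 0 on [P], so that
   expanding the product of [E + G] keeps only the [A] containing [P]. *)
pose E i := if i \in B then r i else 1 - r i.
pose G i := if i \in P then 0 else if i \in B then 1 - r i else r i.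
have -> : \prod_(i in P) r i = \prod_i (E i + G i).
  rewrite big_mkcond; apply: eq_bigr => i _; rewrite /E /G.
  case: ifP => [/(subsetP PB) ->|_]; first by rewrite addr0.
  by case: ifP => _; rewrite ?subrK // addrC subrK.
rewrite bigA_distr big_mkcond /= le_eqVlt; apply/orP; left; apply/eqP.
apply: eq_bigr => A _; rewrite subsetI PB andbT.
case: ifP => [/subsetP PA|/negbT/subsetPn[i iP iA]].
  rewrite /flip_weight big_enum; apply: eq_bigr => i _; rewrite inE /E /G.
  case: (boolP (i \in A)) => iA; last rewrite [i \in P]negbTE.
  - by case: (i \in B).
  - by case: (i \in B).
  - by apply: contra iA => /PA.
by rewrite (bigD1 i) //= (negbTE iA) /G iP mul0r.
Qed.

(** * Counting arithmetic progressions *)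

(** Reading the difference off the first two terms avoids quantifying over integers: the predicate
    is boolean and its domain finite, so it can index sums. *)
Definition is_AP (k n : nat) (e : {ffun 'I_k.+2 -> 'I_n}) : bool :=
  (e ord0 != e (inord 1)) &&
  [forall j : 'I_k.+2,
     elt (e j) == elt (e ord0) + j%:Z * (elt (e (inord 1)) - elt (e ord0))].

Lemma elt_inj (n : nat) : injective (@elt n).
Proof. by move=> i j [/val_inj]. Qed.

Lemma is_AP_inj (k n : nat) (e : {ffun 'I_k.+2 -> 'I_n}) :
  is_AP e -> injective e.
Proof.
case/andP=> ne /forallP ap i j eij; apply/val_inj => /=.
have := eqP (ap i); rewrite eij (eqP (ap j)) => /addrI /mulIf.
rewrite subr_eq0 => H; apply/eqP; rewrite -eqz_nat; apply/eqP/esym/H.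
by apply: contraNneq ne => /elt_inj ->.
Qed.

(** Terms [i] and [j] fix [(j - i) d], hence [d], hence the initial term. *)
Lemma is_AP_determined (k n : nat) (i j : 'I_k.+2)
    (e f : {ffun 'I_k.+2 -> 'I_n}) :
  i != j -> is_AP e -> is_AP f -> e i = f i -> e j = f j -> e = f.
Proof.
move=> nij /andP[_ /forallP ae] /andP[_ /forallP af] ei ej.
have nij0 : j%:Z - i%:Z != 0 by rewrite subr_eq0 eqz_nat eq_sym.
have := eqP (ae i); have := eqP (ae j); rewrite ei ej (eqP (af i)) (eqP (af j)).
set a := elt (e _); set c := elt (f _); set d := _ - a; set d' := _ - c.
move=> hj hi.
have dd : d = d'.
  apply: (mulfI nij0); rewrite !mulrBl; lia.
have ac : a = c by move: hi; rewrite dd => /addIr.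
by apply/ffunP => l; apply: elt_inj; rewrite (eqP (ae l)) (eqP (af l)) -/a -/c -/d -/d' dd ac.
Qed.

Lemma contains_AP_is_AP (k n : nat) (S : {set 'I_n}) :
  contains_AP k.+2 S ->
  exists2 e : {ffun 'I_k.+2 -> 'I_n}, is_AP e & e @: setT \subset S.
Proof.
move=> [a [d [d0 H]]].
have H' (j : 'I_k.+2) : exists i, (i \in S) && (elt i == a + j%:Z * d).
  by have [i iS iE] := H j (ltn_ord j); exists i; rewrite iS iE eqxx.
pose e := [ffun j => xchoose (H' j)].
have eE j : elt (e j) = a + j%:Z * d.
  by rewrite ffunE; have /andP[_ /eqP] := xchooseP (H' j).
have e1 : elt (e (inord 1)) = a + d by rewrite eE inordK // mul1r.
have e0 : elt (e ord0) = a by rewrite eE mul0r addr0.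
exists e.
  apply/andP; split.
    apply: contraNneq d0 => e01; have := e1; rewrite -e01 e0 => /esym/eqP.
    by rewrite -subr_eq0 addrAC subrr add0r.
  by apply/forallP => j; rewrite e1 e0 eE addrAC subrr add0r.
apply/subsetP => _ /imsetP[j _ ->]; rewrite ffunE.
by have /andP[] := xchooseP (H' j).
Qed.

(** Since [e] is recovered from [(e i, e j)], the left side is a subsum of the expanded square. *)
Lemma sum_AP_pair_le (R : numDomainType) (k n : nat) (i j : 'I_k.+2)
    (r : 'I_n -> R) :
  i != j -> (forall x, 0 <= r x) ->
  \sum_(e : {ffun 'I_k.+2 -> 'I_n} | is_AP e) r (e i) * r (e j)
    <= (\sum_x r x) ^+ 2.
Proof.
move=> nij r0.
pose h (e : {ffun 'I_k.+2 -> 'I_n}) := (e i, e j).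
have hinj : {in [pred e | is_AP e] &, injective h}.
  by move=> e f ae af [? ?]; apply: (is_AP_determined nij).
rewrite -(big_imset (fun q => r q.1 * r q.2) hinj) /=.
rewrite expr2 big_distrlr /= pair_bigA /=.
rewrite [leRHS](bigID (mem (h @: [pred e | is_AP e]))) /=.
by rewrite lerDl sumr_ge0 // => q _; rewrite mulr_ge0.
Qed.

Lemma sum_AP_prod_le (R : realFieldType) (m n : nat) (r : 'I_n -> R) :
  (forall x, 0 <= r x <= 2^-1) ->
  \sum_(e : {ffun 'I_m.+4 -> 'I_n} | is_AP e) \prod_j r (e j)
    <= 2^-1 ^+ m * (\sum_x r x ^+ 2) ^+ 2.
Proof.
move=> rb; have r0 x : 0 <= r x by case/andP: (rb x).
pose o (i : nat) : 'I_m.+4 := inord i.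
(* All but four factors are bounded by [2^-1]; AM-GM splits the remaining four into two pairs. *)
have step (e : {ffun 'I_m.+4 -> 'I_n}) : \prod_j r (e j) <=
    2^-1 ^+ m * (2^-1 * (r (e (o 0%N)) ^+ 2 * r (e (o 1%N)) ^+ 2)
               + 2^-1 * (r (e (o 2%N)) ^+ 2 * r (e (o 3%N)) ^+ 2)).
  rewrite !big_ord_recl !mulrA mulrC.
  have -> : o 0%N = ord0 by apply/val_inj; rewrite /= inordK.
  have -> : o 1%N = lift ord0 ord0 by apply/val_inj; rewrite /= inordK.
  have -> : o 2%N = lift ord0 (lift ord0 ord0) by apply/val_inj; rewrite /= inordK.
  have -> : o 3%N = lift ord0 (lift ord0 (lift ord0 ord0)).
    by apply/val_inj; rewrite /= inordK.
  apply: ler_pM; rewrite ?prodr_ge0 ?mulr_ge0 //.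
    apply: le_trans (_ : \prod_(i < m) 2^-1 <= _).
      by apply: ler_prod => i _; apply: rb.
    by rewrite prodr_const card_ord.
  set x := r _; set y := r _; set z := r _; set t := r _.
  have := sqr_ge0 (x * y - z * t); lra.
apply: le_trans (ler_sum _ (fun e _ => step e)) _.
rewrite -mulr_sumr ler_wpM2l ?exprn_ge0 ?invr_ge0 //.
rewrite big_split /= -!mulr_sumr.
have r20 x : 0 <= r x ^+ 2 by rewrite exprn_ge0.
have o01 : o 0%N != o 1%N by rewrite -val_eqE /= !inordK.
have o23 : o 2%N != o 3%N by rewrite -val_eqE /= !inordK.
have := sum_AP_pair_le o01 r20; have := sum_AP_pair_le o23 r20.
lra.
Qed.

(** * From flipped progressions to the density bound *)

Lemma AP_intersecting_card (R : realType) (m n : nat) (F : {set {set 'I_n}}) :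
  AP_intersecting m.+4 F -> mu R F ^+ 3 <= 16 * 2^-1 ^+ m.
Proof.
move=> Fint.
have [//|_ [r [rb rU rs]]] := @flip_rates R _ (enum 'I_n) F (enum_uniq _).
  by move=> B C _ _ H; apply/setP => i; apply: H; rewrite mem_enum.
have r0 B i : 0 <= r B i by case/andP: (rb B i).
rewrite size_enum_ord in rU rs; rewrite /mu.
set f := #|F|%:R in rU rs *; set N := 2%:R ^+ n in rU rs *.
have N0 : 0 < N by rewrite exprn_gt0.
have [f0|fn0] := eqVneq f 0.
  by rewrite f0 mul0r expr0n /= mulr_ge0 ?exprn_ge0 ?invr_ge0.
have fp : 0 < f by rewrite lt_neqAle eq_sym fn0 ler0n.
pose w (A B : {set 'I_n}) := flip_weight (r B) (enum 'I_n) B (~: A).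
have w0 A B : 0 <= w A B.
  apply: prodr_ge0 => i _; case: ifP => _ //.
  by case/andP: (rb B i) => _ ?; rewrite subr_ge0; lra.
pose L (B : {set 'I_n}) := \sum_(i <- enum 'I_n) r B i ^+ 2.
(* With [c = 2^(-m/2)] the bound on flipped progressions is [(c L)^2], ready for
   [min(1, x^2) <= x]. *)
pose c := Num.sqrt (2^-1 ^+ m : R).
have c2 : c ^+ 2 = 2^-1 ^+ m by rewrite sqr_sqrtr ?exprn_ge0 ?invr_ge0.
have Q1 B : \sum_(A in F) w A B <= 1.
  have := sum_flip_weight_supset B set0 (r0 B); rewrite big_set0; apply: le_trans.
  rewrite [leRHS](eq_bigl xpredT) => [|A]; last by rewrite sub0set.
  rewrite [leRHS](bigID (mem F)) /=.
  by rewrite lerDl sumr_ge0 // => A _; apply: w0.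
have Q2 B : B \in F -> \sum_(A in F) w A B <= c ^+ 2 * L B ^+ 2.
  move=> BF; rewrite c2 /L big_enum /=; apply: le_trans (sum_AP_prod_le m (rb B)).
  (* Union bound: every [A] in [F] is counted at least once, through some progression in
     [A :&: B]. *)
  apply: (@le_trans _ _ (\sum_(A in F)
      \sum_(e : {ffun 'I_m.+4 -> 'I_n} | is_AP e && (e @: setT \subset A :&: B))
        w A B)).
    apply: ler_sum => A AF; have [e ae eAB] := contains_AP_is_AP (Fint A B AF BF).
    by rewrite (bigD1 e) ?ae //= lerDl sumr_ge0 // => e' _; apply: w0.
  under eq_bigr => A _ do rewrite big_mkcondr /=.
  rewrite exchange_big /=; apply: ler_sum => e ae.
  have -> : \prod_j r B (e j) = \prod_(i in e @: setT) r B i.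
    rewrite big_imset /=; last by move=> i j _ _; apply: is_AP_inj.
    by apply: eq_bigl => j; rewrite inE.
  apply: le_trans (sum_flip_weight_supset B (e @: setT) (r0 B)).
  rewrite -big_mkcondr big_mkcondl /=; apply: ler_sum => A _.
  by case: ifP => _ //; apply: w0.
have Q B : B \in F -> \sum_(A in F) w A B <= c * L B.
  move=> BF; have := Q1 B; have := Q2 B BF; rewrite -exprMn.
  have : 0 <= c * L B.
    by rewrite mulr_ge0 ?sqrtr_ge0 ?sumr_ge0 // => i _; rewrite exprn_ge0.
  move: (c * L B) => x x0; have [x1|/ltW x1 _] := lerP x 1; last first.
    by move=> /le_trans; apply.
  by move=> /le_trans + _; apply; rewrite expr2 ler_piMr.
(* The total weight over [F] squared, counted in two ways: uniformity of the outcome gives the left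
   side, [Q] and the cost bound the right. *)
have key : f * (f / N) <= c * (4 * Num.sqrt (f * N)).
  have -> : f * (f / N) = \sum_(A in F) \sum_(B in F) w A B.
    under eq_bigr => A _ do rewrite rU.
    by rewrite sumr_const -mulr_natl.
  rewrite exchange_big /=; apply: le_trans (ler_sum _ Q) _.
  by rewrite -mulr_sumr ler_wpM2l ?sqrtr_ge0.
have fN0 : 0 <= f * N by rewrite mulr_ge0 ?ltW.
have key2 : (f * (f / N)) ^+ 2 <= 2^-1 ^+ m * (16 * (f * N)).
  have -> : 2^-1 ^+ m * (16 * (f * N)) = (c * (4 * Num.sqrt (f * N))) ^+ 2.
    by rewrite !exprMn c2 sqr_sqrtr // -natrX.
  by rewrite ler_pXn2r ?nnegrE ?mulr_ge0 ?sqrtr_ge0 ?invr_ge0 ?(ltW fp) ?(ltW N0).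
have -> : (f / N) ^+ 3 = (f * (f / N)) ^+ 2 / (f * N).
  by field; rewrite fn0 gt_eqF.
rewrite ler_pdivrMr ?mulr_gt0 //; lra.
Qed.

Theorem theorem2p1 (R : realType) :
  exists k0 : nat, forall k : nat, (k0 <= k)%N ->
  forall n : nat, (0 < n)%N ->
  forall F : {set {set 'I_n}}, AP_intersecting k F ->
  mu R F <= k%:R `^ (- (1 / 3)).
Proof.
(* Twelve is the least [k] from which [16 k <= 2^(k - 4)] holds throughout; this inequality turns
   the exponential bound on [mu^3] into [1 / k]. *)
exists 12 => k k12 n _ F.
have -> : k = (k - 4).+4 by lia.
have : (8 <= k - 4)%N by lia.
move: (k - 4)%N => m {k k12} m8 /(AP_intersecting_card R) mu3.
have pow2 : (16 * m.+4 <= 2 ^ m)%N.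
  elim: m m8 {mu3} => // m IH; rewrite leq_eqVlt => /predU1P[<- //|m8].
  by have := IH m8; rewrite expnS; lia.
set y := _ `^ _.
have y3 : y ^+ 3 = m.+4%:R^-1.
  rewrite -powR_mulrn ?powR_ge0 // -powRrM.
  by rewrite (_ : - (1 / 3) * 3%:R = - 1 :> R) ?powR_inv1 //; field.
rewrite -(@ler_pXn2r _ 3) ?nnegrE ?powR_ge0 ?divr_ge0 ?exprn_ge0 //.
apply: le_trans mu3 _; rewrite y3 exprVn ler_pdivrMr ?exprn_gt0 //.
by rewrite mulrC ler_pdivlMr // -natrX -natrM ler_nat.
Qed.
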